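(* Let $G$ be an infinite finitely generated virtually nilpotent group. Then $G$ is periodically rigid if and only if $G$ is either virtually $\mathbb Z$, or torsion-free and virtually $\mathbb Z^2$.
   Context: For a class $\mathcal P$ of groups, a group is virtually $\mathcal P$ if it has a finite index subgroup in $\mathcal P$; in particular it is virtually $\mathbb Z^d$ if it has a finite index subgroup isomorphic to $\mathbb Z^d$. Let $A$ be a non-empty finite set. $G$ acts on $A^G$ by $(g\cdot x)(h)=x(g^{-1}h)$. A pattern is a map $p:F\to A$ with $F\subset G$ finite; it appears in $x\in A^G$ if there is $g\in G$ with $p(h)=x(gh)$ for all $h\in F$. A subset $X\subseteq A^G$ is a subshift of finite type ($G$-SFT) if it consists of exactly those configurations in which no pattern of some finite set of patterns appears. A $G$-SFT $X$ is weakly aperiodic if it is non-empty and every $x\in X$ has infinite orbit $\{g\cdot x:g\in G\}$; it is strongly aperiodic if it is non-empty and $\mathrm{stab}(x)=\{g\in G:g\cdot x=x\}$ is trivial for every $x\in X$. A group $G$ is periodically rigid if every weakly aperiodic $G$-SFT (over any finite alphabet) is strongly aperiodic. *)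

(* Defs.v *)
From HB Require Import structures.
From mathcomp Require Import all_boot all_order all_algebra.
From mathcomp Require Import finmap.
From mathcomp Require Import boolp classical_sets functions cardinality.

Set Implicit Arguments.
Unset Strict Implicit.
Unset Printing Implicit Defensive.

Local Open Scope classical_set_scope.
Local Open Scope group_scope.

Section GroupNotions.
Variable G : groupType.

Definition is_subgroup (H : set G) : Prop := group_closed [in H].

Definition generated (S : set G) : set G := smallest is_subgroup S.

Definition finitely_generated : Prop :=
  exists2 S : set G, finite_set S & generated S = setT.

Definition torsion_free : Prop :=
  forall (g : G) (n : nat), (0 < n)%N -> g ^+ n = 1 -> g = 1.

Fixpoint lower_central (n : nat) : set G :=
  if n is m.+1
  then generated [set c | exists2 a, lower_central m a & exists b, c = [~ a, b]]
  else setT.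

Definition nilpotent_group : Prop := exists c : nat, lower_central c = [set 1].

Definition left_coset (S : {pred G}) (g : G) : set G :=
  [set g * h | h in [set` S]].

Definition finite_index (S : {pred G}) : Prop :=
  finite_set (range (left_coset S)).

Definition isomorphic_to_Zd (d : nat) : Prop :=
  exists2 phi : G -> 'rV[int]_d,
    bijective phi & {morph phi : x y / x * y >-> (x + y)%R}.

End GroupNotions.

(* [H : SubGroup.type S] is a group structure on the subtype of [G] cut out by
   [S], compatible with that of [G]; this forces [S] to be a subgroup. *)
Definition virtually (P : groupType -> Prop) (G : groupType) : Prop :=
  exists (S : {pred G}) (H : SubGroup.type S), finite_index S /\ P H.

Definition virtually_nilpotent : groupType -> Prop := virtually nilpotent_group.

Definition virtually_Zd (d : nat) : groupType -> Prop :=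
  virtually (fun H => isomorphic_to_Zd H d).

Section Subshifts.
Variables (G : groupType) (A : finType).

Definition shift (g : G) (x : G -> A) : G -> A := fun h => x (g^-1 * h).

Definition shift_orbit (x : G -> A) : set (G -> A) := range (shift^~ x).

Definition shift_stab (x : G -> A) : set G := [set g | shift g x = x].

(* A pattern F -> A with F a finite subset of G is a finite map [{fmap G -> A}]
   with domain F. *)
Definition appears (p : {fmap G -> A}) (x : G -> A) : Prop :=
  exists g : G, forall h : domf p, p h = x (g * val h).

Definition is_SFT (X : set (G -> A)) : Prop :=
  exists P : {fset {fmap G -> A}},
    X = [set x | forall p, p \in P -> ~ appears p x].

Definition weakly_aperiodic (X : set (G -> A)) : Prop :=
  X !=set0 /\ forall x, X x -> infinite_set (shift_orbit x).

Definition strongly_aperiodic (X : set (G -> A)) : Prop :=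
  X !=set0 /\ forall x, X x -> shift_stab x = [set 1].

End Subshifts.

Definition periodically_rigid (G : groupType) : Prop :=
  forall (A : finType) (X : set (G -> A)), (0 < #|A|)%N ->
    is_SFT X -> weakly_aperiodic X -> strongly_aperiodic X.

(* Main.v *)
Require Import Defs.
From HB Require Import structures.
From mathcomp Require Import all_boot all_order all_algebra.
From mathcomp Require Import zify ring lra.
From mathcomp Require Import finmap.
From mathcomp Require Import boolp classical_sets functions cardinality.

(** Rigidity of virtually Z and of torsion-free virtually Z^2 groups comes from
    periodization.  If a configuration [x] is fixed by [v], and if [v] together
    with a commuting [w] that is free modulo [v] generates a subgroup of finite
    index, then [x] is in effect a bi-infinite word over a finite alphabet, read
    along [w], and the finitely many forbidden patterns only see windows of
    bounded width of that word.  Two equal windows let one repeat the stretch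
    between them forever, which gives a configuration with finite orbit in the
    same subshift ([periodize]).  With [v = 1] this shows that a virtually Z
    group has no weakly aperiodic subshift of finite type at all.  With [v] a
    power of a nontrivial period, it shows that a weakly aperiodic one on a
    torsion-free virtually Z^2 group has trivial stabilizers.

    The converse rests on one construction.  Let [p] and [q] span a copy [M] of
    Z^2 in [G], and let [t] be an element no nontrivial power of which is
    conjugate into [M].  Asking a configuration to tile each left coset of [M],
    seen as a copy of Z^2, by an aperiodic set of tiles defines a subshift of
    finite type on [G].  Every configuration in it has infinite orbit, because
    its restriction to [M] does; but nothing relates different cosets, and [<t>]
    permutes them freely, so that the same tiling can be written on all the
    cosets of each [<t>]-orbit and the result is fixed by [t].  Hence in a periodically rigid group every nontrivial element has a
    nontrivial power conjugate into any given copy of Z^2 ([rigid_power_conj]).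
    The aperiodic tiling is in the style of Kari: row [j] spells the Beatty
    sequence of a rational [x_j], and going up one row multiplies the number
    by 2 or 2/3.  A doubly periodic tiling would make 2^m a product of ones
    and threes.

    Now let [G] be rigid and [N] a nilpotent subgroup of finite index, which is
    finitely generated by Schreier's lemma.
    - If [G] has a nontrivial torsion element, it contains no Z^2.  Then either
      the centre of [N] is torsion, which would make [N] torsion and so finite,
      or some central [z] has infinite order; every element of [N] has a power
      in [<z>], and descending the upper central series shows that [<z>] has
      finite index ([rigid_torsion_virtually_Z]).
    - If [G] is torsion-free and [N] is not abelian, take [a] in the second
      centre of [N] and [b] with [d = [~ b, a] <> 1].  All conjugates of
      [<d, a>] lie in finitely many abelian subgroups, whereas nonzero powers of
      two distinct elements [a b^i] never commute, which contradicts rigidity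
      ([rigid_torsion_free_abelian]).
    - If [G] is torsion-free and [N] is abelian, then [N] is free abelian
      ([torsion_free_spanned_Zd]).  If its rank is at least 3, the conjugates
      of a rank 2 direct summand lie in finitely many planes up to taking powers,
      and these cannot contain nonzero multiples of all the points
      (1, i, i^2, ...) of the moment curve ([rigid_rank_le2]).
    So [N] has rank 1 or 2 in the torsion-free case. *)

Set Implicit Arguments.
Unset Strict Implicit.
Unset Printing Implicit Defensive.

Import Order.TTheory GRing.Theory Num.Theory.
Local Open Scope classical_set_scope.
Local Open Scope group_scope.

(** * Integer powers and group morphisms *)

Definition zpow (G : groupType) (x : G) (n : int) : G :=
  match n with Posz m => x ^+ m | Negz m => x ^- m.+1 end.

Section IntegerPowers.
Variable G : groupType.
Implicit Types (x y : G) (m n : int).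

Lemma zpowNn x (n : nat) : zpow x (- n%:Z)%R = x ^- n.
Proof. by case: n => [|n]; rewrite ?oppr0 ?expg0 ?invg1 // -NegzE. Qed.

Lemma zpow1 x : zpow x 1%R = x. Proof. exact: expg1. Qed.

Lemma zpow1n n : zpow 1 n = 1 :> G.
Proof. by case: n => n; rewrite /zpow expg1n ?invg1. Qed.

Lemma zpowSr x n : zpow x (n + 1)%R = zpow x n * x.
Proof.
case: n => n.
  have -> : (n%:Z + 1 = n.+1)%R by lia.
  exact: expgSr.
rewrite NegzE (_ : (- n.+1%:Z + 1)%R = (- n%:Z)%R); last by lia.
by rewrite !zpowNn expgS invgM mulgVK.
Qed.

Lemma zpowBr x n : zpow x (n - 1)%R = zpow x n * x^-1.
Proof. by rewrite -{2}[n](subrK 1%R) zpowSr mulgK. Qed.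

Lemma zpowD x m n : zpow x (m + n)%R = zpow x m * zpow x n.
Proof.
elim/int_ind: n => [|n IHn|n IHn]; first by rewrite addr0 mulg1.
  by rewrite intS (addrC 1%R) addrA !zpowSr IHn mulgA.
by rewrite intS opprD (addrC (- 1)%R) addrA !zpowBr IHn mulgA.
Qed.

Lemma zpowN x n : zpow x (- n)%R = (zpow x n)^-1.
Proof. by apply/esym/mulg1_eq; rewrite -zpowD subrr. Qed.

Lemma zpowB x m n : zpow x (m - n)%R = zpow x m * (zpow x n)^-1.
Proof. by rewrite zpowD zpowN. Qed.

Lemma commute_zpow x y n : commute x y -> commute x (zpow y n).
Proof. by case: n => n xy; [|apply: commuteV]; apply: commuteX. Qed.

Lemma commute_zpow2 x y m n : commute x y -> commute (zpow x m) (zpow y n).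
Proof.
by move=> xy; apply/commute_zpow/commute_sym/commute_zpow/commute_sym.
Qed.

Lemma zpowM x m n : zpow x (m * n)%R = zpow (zpow x m) n.
Proof.
elim/int_ind: n => [|n IHn|n IHn]; first by rewrite mulr0.
  by rewrite intS mulrDr mulr1 zpowD IHn zpowD zpow1.
by rewrite intS opprD mulrDr mulrN1 !zpowD IHn !zpowN zpow1.
Qed.

Lemma conj_zpow x y n : zpow x n ^ y = zpow (x ^ y) n.
Proof. by case: n => n; rewrite /zpow ?conjVg conjXg. Qed.

End IntegerPowers.

Section Morphisms.
Variables (H G : groupType) (f : H -> G).
Hypothesis fM : {morph f : x y / x * y}.

Lemma morph1 : f 1 = 1.
Proof. by apply: (@mulIg _ (f 1)); rewrite -fM !mul1g. Qed.

Lemma morphV x : f x^-1 = (f x)^-1.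
Proof. by apply/esym/mulg1_eq; rewrite -fM mulgV morph1. Qed.

Lemma morphX x n : f (x ^+ n) = f x ^+ n.
Proof. by elim: n => [|n IHn]; rewrite ?expg0 ?morph1 // !expgS fM IHn. Qed.

Lemma morphJ x y : f (x ^ y) = f x ^ f y.
Proof. by rewrite /conjg !fM morphV. Qed.

Lemma morph_zpow x n : f (zpow x n) = zpow (f x) n.
Proof. by case: n => n; rewrite /zpow ?morphV morphX. Qed.

End Morphisms.

Section ExponentMaps.
Variables (d : nat) (H : groupType) (psi : 'rV[int]_d -> H).
Hypothesis psiD : forall x y, psi (x + y)%R = psi x * psi y.

Lemma expmap0 : psi 0%R = 1.
Proof. by apply: (@mulIg _ (psi 0%R)); rewrite -psiD addr0 mul1g. Qed.

Lemma expmapN x : psi (- x)%R = (psi x)^-1.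
Proof. by apply/esym/mulg1_eq; rewrite -psiD subrr expmap0. Qed.

Lemma expmapZ n x : psi (n *: x)%R = zpow (psi x) n.
Proof.
elim/int_ind: n => [|n IHn|n IHn]; first by rewrite scale0r expmap0.
  by rewrite intS scalerDl scale1r psiD IHn zpowD zpow1.
by rewrite intS opprD scalerDl scaleN1r psiD IHn expmapN zpowD !zpowN zpow1.
Qed.

End ExponentMaps.


(** * Subshifts of finite type and local rules *)

(** Membership in a subshift of finite type is decided by the patterns seen
    through one finite window [E], a common bound for the domains of the
    forbidden patterns: replacing a member by a configuration all of whose
    windows occur in it cannot leave the subshift. *)
Lemma SFT_window (G : groupType) (A : finType) (X : set (G -> A)) :
    is_SFT X ->
  exists E : seq G, forall x y, X x ->
    (forall g, exists g', {in E, forall e, y (g * e) = x (g' * e)}) -> X y.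
Proof.
case=> P ->; exists (flatten [seq enum_fset (domf p) | p : {fmap G -> A} <- P]).
move=> x y /= Xx xy p pP [g gp]; apply: (Xx p pP).
have [g' g'P] := xy g; exists g' => h; rewrite gp g'P //.
apply/flattenP; exists (enum_fset (domf p)); last exact: valP.
by apply/mapP; exists p.
Qed.

(** The finitely many maps [D -> A] violating [R] are the forbidden patterns. *)
Lemma local_rule_SFT (G : groupType) (A : finType) (D : {fset G})
    (R : pred {ffun D -> A}) :
  is_SFT [set x : G -> A | forall g, R [ffun d => x (g * val d)]].
Proof.
exists [fset (FinMap f : {fmap G -> A}) | f in [seq f <- enum {ffun D -> A} | ~~ R f]]%fset.
apply/seteqP; split => x /= Rx.
  move=> p /imfsetP[/= f]; rewrite mem_filter => /andP[Rf _] -> [g gf].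
  move/negP: Rf; apply; rewrite (_ : f = [ffun d => x (g * val d)]) //.
  by apply/ffunP => d; rewrite ffunE -gf.
move=> g; apply: contrapT => /negP Rg.
apply: (Rx (FinMap [ffun d : D => x (g * val d)])).
  by apply/imfsetP; eexists; last reflexivity; rewrite /= mem_filter Rg mem_enum.
by exists g => h; rewrite /= ffunE.
Qed.

Lemma corner_rule_SFT (G : groupType) (A : finType) (p q : G)
    (R : A -> A -> A -> bool) :
  is_SFT [set x : G -> A | forall g, R (x g) (x (g * p)) (x (g * q))].
Proof.
pose D := [fset 1; p; q]%fset.
have D1 : 1 \in D by rewrite !inE eqxx.
have Dp : p \in D by rewrite !inE eqxx orbT.
have Dq : q \in D by rewrite !inE eqxx orbT.
have := @local_rule_SFT G A D (fun f => R (f [` D1]%fset) (f [` Dp]%fset) (f [` Dq]%fset)).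
congr is_SFT; apply/seteqP; split => x /= Rx g; have := Rx g; rewrite !ffunE /= mulg1 //.
Qed.

(** * An aperiodic local rule on the square lattice *)

(** A cell carries a digit, a carry shifted by one to make it a natural number,
    and whether its row multiplies by 2/3 (divisor 3) or by 2 (divisor 1). *)
Definition cell : finType := ('I_4 * 'I_4 * bool)%type.
Definition digit (t : cell) : nat := t.1.1.
Definition carry (t : cell) : nat := t.1.2.
Definition divisor (t : cell) : nat := (if t.2 then 3 else 1)%N.

(** The cells [r] and [u] are the right and upper neighbours of [t].  The
    equation is a step of a division with carry: summed over a row, the carries
    telescope and twice the digit sum of the row is the divisor times the digit
    sum of the row above. *)
Definition kari_rule (t r u : cell) : bool :=
  [&& 0 < digit t, digit t * 2 + carry t == digit u * divisor t + carry r
    & t.2 == r.2]%N.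

(** Over one horizontal period the digit sums satisfy
    [2 * s j = divisor j * s j.+1].  After a vertical period [m] this makes the
    positive number [s 0] satisfy [2 ^ m * s 0 = odd * s 0]. *)
Lemma kari_aperiodic (f : nat -> nat -> cell) (n m : nat) :
    (forall i j, kari_rule (f i j) (f i.+1 j) (f i j.+1)) ->
    (0 < n)%N -> (0 < m)%N ->
    (forall i j, f (i + n)%N j = f i j) ->
  ~ (forall i j, f i (j + m)%N = f i j).
Proof.
move=> rule n0 m0 fn fm.
pose s j := (\sum_(i < n) digit (f i j))%N.
have s_gt0 j : (0 < s j)%N.
  rewrite /s (bigD1 (Ordinal n0)) //= addn_gt0.
  by case/and3P: (rule 0 j) => ->.
have divisor0 i j : divisor (f i j) = divisor (f 0 j).
  elim: i => // i <-; rewrite /divisor.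
  by case/and3P: (rule i j) => _ _ /eqP->.
have sS j : (s j * 2 = s j.+1 * divisor (f 0 j))%N.
  have cc : (\sum_(i < n) carry (f i j) = \sum_(i < n) carry (f i.+1 j))%N.
    case: n n0 fn {s s_gt0} => // n _ fn; rewrite big_ord_recl big_ord_recr addnC.
    by congr (_ + carry _)%N; rewrite -[in LHS](fn 0).
  apply/eqP; rewrite -(eqn_add2r (\sum_(i < n) carry (f i j))) {2}cc.
  rewrite /s !big_distrl -!big_split /=; apply/eqP/eq_bigr => i _.
  by rewrite -(divisor0 i); case/and3P: (rule i j) => _ /eqP.
have sX k : (s 0 * 2 ^ k = s k * \prod_(j < k) divisor (f 0 j))%N.
  elim: k => [|k IHk]; first by rewrite big_ord0.
  by rewrite big_ord_recr /= expnSr mulnA IHk mulnAC sS -mulnA (mulnC (divisor _)).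
have s0m : s m = s 0 by apply: eq_bigr => i _; rewrite -[in RHS](fm i 0).
have /eqP := sX m; rewrite s0m eqn_pmul2l //.
move/eqP/(congr1 odd); rewrite oddX (negPf (lt0n_neq0 m0)) /=.
suff -> : odd (\prod_(j < m) divisor (f 0 j)) by [].
elim/big_ind: _ => // [a b oa ob|j _]; first by rewrite oddM oa.
by rewrite /divisor; case: ifP.
Qed.

Local Open Scope ring_scope.

(** This map is a bijection of the half-open interval from 1 (included) to 3, so
    that it has two-sided orbits; that of 1 consists of rational numbers. *)
Definition mult_map (x : rat) : rat := if x < 3 / 2 then 2 * x else x * 2 / 3.
Definition mult_map_inv (y : rat) : rat := if y < 2 then 3 / 2 * y else y / 2.

Definition mult_orbit (j : int) : rat :=
  match j with
  | Posz n => iter n mult_map 1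
  | Negz n => iter n.+1 mult_map_inv 1
  end.

Lemma mult_orbit_itv j : 1 <= mult_orbit j < 3.
Proof.
case: j => n; rewrite /mult_orbit; [elim: n | elim: (n.+1)] => // {}n /=.
  by rewrite /mult_map; move: (iter _ _ _) => x; case: ifP => ? ?; lra.
by rewrite /mult_map_inv; move: (iter _ _ _) => x; case: ifP => ? ?; lra.
Qed.

Lemma mult_orbitS j : mult_orbit (j + 1) = mult_map (mult_orbit j).
Proof.
case: j => n; first by have -> : n%:Z + 1 = n.+1 by lia.
have -> : mult_orbit (Negz n + 1) = iter n mult_map_inv 1.
  by case: n => [|n] //; have -> : Negz n.+1 + 1 = Negz n by lia.
have : 1 <= iter n mult_map_inv 1 < 3.
  by case: n => [|n] //; apply: (mult_orbit_itv (Negz n)).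
rewrite /mult_orbit iterS; move: (iter _ _ _) => x.
rewrite /mult_map /mult_map_inv => xP.
by case: (ltP x 2) => ?; case: ifP => ?; lra.
Qed.

Definition kari_row (j : int) : bool := 3 / 2 <= mult_orbit j.
Definition beatty (i j : int) : int := Num.floor (i%:~R * mult_orbit j).

(** The digits in row [j] are the increments of the Beatty sequence
    [floor (i * x_j)], and the carry is the rounding error between twice this
    sequence and the divisor times the sequence of the next row. *)
Definition kari_tiling (i j : int) : cell :=
  (inord `|beatty (i + 1) j - beatty i j|,
   inord `|2 * beatty i j - (if kari_row j then 3 else 1) * beatty i (j + 1) + 1|,
   kari_row j).

Lemma kari_tilingP i j :
  kari_rule (kari_tiling i j) (kari_tiling (i + 1) j) (kari_tiling i (j + 1)).
Proof.
have beattyP i' j' : ((beatty i' j')%:~R : rat) <= i'%:~R * mult_orbit j'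
                       < (beatty i' j')%:~R + 1.
  by have := floor_itv (i'%:~R * mult_orbit j'); rewrite intrD.
have digitP (i' j' : int) : (1 : int) <= beatty (i' + 1) j' - beatty i' j' <= 3.
  have := beattyP i' j'; have := beattyP (i' + 1) j'.
  have := mult_orbit_itv j'; rewrite intrD mulrDl mul1r.
  set b := beatty _ _; set b' := beatty _ _; move: (_ * _) => z xP zP zP'.
  have : (0 : rat) < (b - b')%:~R by rewrite intrB; lra.
  have : (b - b')%:~R < (4 : rat) by rewrite intrB; lra.
  by rewrite (ltr_int _ _ 4) ltr0z => ? ?; lia.
have muP : mult_orbit (j + 1) * (if kari_row j then 3 else 1) = 2 * mult_orbit j.
  by rewrite mult_orbitS /mult_map /kari_row; case: ltP => ?; lra.
have carryP (i' : int) : (0 : int) <= 2 * beatty i' j -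
    (if kari_row j then 3 else 1) * beatty i' (j + 1) + 1 <= 3.
  have := beattyP i' j; have := beattyP i' (j + 1); move: muP.
  set b := beatty _ _; set b' := beatty _ _; move: (i'%:~R) => z muP bP bP'.
  set m : int := if _ then _ else _.
  have mE : m%:~R = (if kari_row j then 3 else 1) :> rat by rewrite /m; case: ifP.
  have m_itv : 1 <= (m%:~R : rat) <= 3 by rewrite mE; case: ifP.
  rewrite -mE in muP.
  have zm : m%:~R * (z * mult_orbit (j + 1)) = 2 * (z * mult_orbit j).
    by rewrite mulrCA (mulrC m%:~R) muP mulrCA.
  have mb1 : m%:~R * b%:~R <= m%:~R * (z * mult_orbit (j + 1)).
    by rewrite ler_pM2l; lra.
  have mb2 : m%:~R * (z * mult_orbit (j + 1)) < m%:~R * (b%:~R + 1).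
    by rewrite ltr_pM2l; lra.
  (* Rounding down loses less than 1 in each of the two Beatty terms. *)
  have h1 : (-1 : rat) < (2 * b' - m * b + 1)%:~R.
    by rewrite intrD intrB !intrM; lra.
  have h2 : (2 * b' - m * b + 1)%:~R < (4 : rat).
    by rewrite intrD intrB !intrM; lra.
  rewrite (ltr_int _ _ 4) in h2; rewrite (ltr_int _ (-1)) in h1; lia.
apply/and3P; split => //=.
  by rewrite /digit /= inordK; move: (digitP i j); move: (_ - _) => b; lia.
rewrite /digit /carry /divisor /=.
have := digitP i j; have := digitP i (j + 1); have := carryP i.
have := carryP (i + 1).
case: kari_row => *; rewrite !inordK; lia.
Qed.
Local Close Scope ring_scope.

(** * Weakly aperiodic subshifts with a prescribed period *)

Lemma pigeonhole_nat (T : Type) (A : set T) (f : nat -> T) :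
  finite_set A -> (forall n, A (f n)) -> exists i j, (i < j)%N /\ f i = f j.
Proof.
move=> finA fA; apply: contrapT => noij.
have f_inj : injective f.
  move=> i j fij; case: (ltngtP i j) => // ij; exfalso; apply: noij.
    by exists i, j.
  by exists j, i.
have finf : finite_set (range f) by apply: sub_finite_set finA => _ [n _ <-].
apply: infinite_nat; rewrite -(eq_finite_set (@inj_card_eq _ _ setT f _)) //.
by move=> i j _ _; apply: f_inj.
Qed.

Lemma finite_orbit_period (G : groupType) (A : finType) (x : G -> A) (p : G) :
    finite_set (shift_orbit x) ->
  exists2 n, (0 < n)%N & forall h, x (p ^+ n * h) = x h.
Proof.
move=> finx; have [|i [j [ij]]] := @pigeonhole_nat _ _ (fun n => shift (p ^- n) x) finx.
  by move=> n; exists (p ^- n).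
move=> /funeqP xij; exists (j - i)%N => [|h]; first by rewrite subn_gt0.
have := xij (p ^- i * h); rewrite /shift !invgK !mulgA mulgV mul1g => ->.
by rewrite expgnFr // ltnW.
Qed.

(** The hypothesis says that [<t>], acting on the left, and the group spanned by
    [p] and [q], acting on the right, act freely together on [G].  Each orbit is
    then a family of copies of Z^2 permuted by [t], on all of which the same
    aperiodic tiling is written. *)
Lemma SFT_with_period (G : groupType) (p q t : G) :
    commute p q ->
    (forall g k i j, zpow t k = (zpow p i * zpow q j) ^ g -> i = 0%R /\ j = 0%R) ->
  exists (A : finType) (X : set (G -> A)),
    [/\ (0 < #|A|)%N, is_SFT X, weakly_aperiodic X
      & exists2 x, X x & shift t x = x].
Proof.
move=> pq free; pose X := [set x : G -> cell |
  forall g, kari_rule (x g) (x (g * p)) (x (g * q))].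
pose ijpow (c : int * int) := zpow p c.1 * zpow q c.2.
have ijpowD c c' : ijpow c * ijpow c' = ijpow (c + c')%R.
  rewrite /ijpow /= !zpowD !mulgA; congr (_ * _); rewrite -!mulgA; congr (_ * _).
  exact/commute_sym/commute_zpow2.
have ijpow0 : ijpow 0%R = 1 by rewrite /ijpow mulg1.
have ijpowN c : ijpow (- c)%R = (ijpow c)^-1.
  by apply/esym/mulg1_eq; rewrite ijpowD subrr.
pose E g := [set h | exists k c, g = zpow t k * h * ijpow c].
have E_eq g k c : E (zpow t k * g * ijpow c) = E g.
  apply/seteqP; split=> h [k' [c' gE]].
    exists (- k + k')%R, (c' - c)%R; rewrite -ijpowD ijpowN zpowD zpowN.
    rewrite -[LHS](mulgK (ijpow c)) -[in LHS](mulKg (zpow t k) g).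
    by rewrite -(mulgA (zpow t k)^-1) gE !mulgA.
  by exists (k + k')%R, (c' + c)%R; rewrite zpowD -ijpowD gE !mulgA.
(* The representative depends on the orbit only, since [E] does. *)
pose rep g := xget 1 (E g).
have /choice[c cP] : forall g, exists c, exists k, g = zpow t k * rep g * ijpow c.
  move=> g; have [k [c gE]] : E g (rep g); last by exists c, k.
  by apply: (xgetPex 1); exists g, 0%R, 0%R; rewrite ijpow0 mul1g mulg1.
have c_uniq g k c' : g = zpow t k * rep g * ijpow c' -> c g = c'.
  have [k' {1}->] := cP g => eq_g.
  suff : (c' - c g = 0)%R by move/eqP; rewrite subr_eq0 => /eqP.
  have [|] := free (rep g)^-1 (k' - k)%R (c' - c g)%R.1 (c' - c g)%R.2.
    rewrite -/(ijpow (c' - c g)%R) -ijpowD ijpowN conjgE invgK addrC zpowD zpowN.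
    move: (ijpow _) (ijpow _) eq_g => C' C eq_g.
    apply: (@mulgI _ (zpow t k)); apply: (@mulIg _ (rep g * C)).
    by rewrite !mulgA mulgV mul1g eq_g !mulgVK.
  by case: (c' - c g)%R => /= ? ? -> ->.
have c_act g k c' : c (zpow t k * g * ijpow c') = (c g + c')%R.
  have [k' gE] := cP g; apply: (c_uniq _ (k + k')%R).
  by rewrite /rep E_eq -/(rep g) zpowD -ijpowD !mulgA {1}gE !mulgA.
pose x g := kari_tiling (c g).1 (c g).2.
have Xx : X x.
  move=> g; rewrite /x.
  have -> : c (g * p) = (c g + (1, 0))%R.
    by rewrite -(c_act g 0%R) /ijpow [zpow p _]zpow1 mulg1 mul1g.
  have -> : c (g * q) = (c g + (0, 1))%R.
    by rewrite -(c_act g 0%R) /ijpow [zpow q _]zpow1 !mul1g.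
  by rewrite /= !addr0; apply: kari_tilingP.
exists cell, X; split.
- by apply/card_gt0P; exists (ord0, ord0, false).
- exact: corner_rule_SFT.
- split; first by exists x.
  move=> y Xy finy.
  have [n n0 yn] := finite_orbit_period p finy.
  have [m m0 ym] := finite_orbit_period q finy.
  have cpq i j : commute (p ^+ i) (q ^+ j) by apply: commuteX2.
  apply: (@kari_aperiodic (fun i j => y (p ^+ i * q ^+ j)) n m) => // i j.
  - have := Xy (p ^+ i * q ^+ j); congr kari_rule; congr y.
      by rewrite -mulgA -(cpq 1%N) mulgA -expgSr.
    by rewrite -mulgA -expgSr.
  - by rewrite addnC expgnDr -mulgA yn.
  - by rewrite addnC expgnDr mulgA (cpq i m) -mulgA ym.
- exists x => //.
  apply/funext => h; rewrite /shift /x.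
  by have := c_act h (-1)%R 0%R; rewrite ijpow0 mulg1 addr0 zpowN zpow1 => ->.
Qed.

Definition independent (G : groupType) (p q : G) : Prop :=
  forall i j, zpow p i * zpow q j = 1 -> i = 0%R /\ j = 0%R.

(** The only way in which rigidity of [G] is used: otherwise [SFT_with_period]
    yields a weakly aperiodic subshift with a configuration of period [t]. *)
Lemma rigid_power_conj (G : groupType) (p q t : G) :
    periodically_rigid G -> commute p q -> independent p q -> t <> 1 ->
  exists k g i j, [/\ (0 < k)%N, t ^+ k <> 1
    & t ^+ k = (zpow p i * zpow q j) ^ g].
Proof.
move=> rigG pq indep t1; apply: contrapT => no_conj.
have free_nat g (k : nat) i j :
    t ^+ k = (zpow p i * zpow q j) ^ g -> i = 0%R /\ j = 0%R.
  move=> tk; apply: indep; apply/eqP; rewrite -(conjg_eq1 _ g) -tk; apply/eqP.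
  apply: contrapT => tk1; apply: no_conj; exists k, g, i, j; split => //.
  by case: k tk1 {tk} => // /(_ (expg0 t)).
have [|A [X [A0 sftX /(rigG A X A0 sftX)[_ stabX] [x /stabX xP tx]]]] :=
  @SFT_with_period G p q t pq; last first.
  by have : shift_stab x t by []; rewrite xP.
move=> g [k|k] i j; first exact: free_nat.
move=> tkN; have tk : t ^+ k.+1 = ((zpow p i * zpow q j) ^ g)^-1.
  by rewrite -tkN invgK.
have [|i0 j0] := free_nat g k.+1 (- i)%R (- j)%R; last by split; lia.
rewrite tk -conjVg invgM !zpowN; congr (_ ^ _).
by apply/commute_sym/commuteV/commute_sym/commuteV/commute_sym/commute_zpow2.
Qed.

(** * Periodization along a virtually cyclic direction *)

(** Modulo the period [v], the group is a bi-infinite sequence of finite layers,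
    translated into each other by [w]; [bt] is the height of an element, i.e.
    the index of its layer. *)
Lemma periodize (G : groupType) (A : finType) (X : set (G -> A)) (v w : G)
    (D : seq G) (x : G -> A) :
    commute v w ->
    (forall a b, zpow v a * zpow w b = 1 -> b = 0%R) ->
    (forall h, exists a b, exists2 d, d \in D & h = zpow v a * zpow w b * d) ->
    is_SFT X -> X x -> (forall h, x (v * h) = x h) ->
  exists2 y, X y & finite_set (shift_orbit y).
Proof.
move=> vw free cover /SFT_window[E XE] Xx xv1.
have vwc a b : commute (zpow v a) (zpow w b) by apply: commute_zpow2.
have vwD a b a' b' h : zpow v a * zpow w b * (zpow v a' * zpow w b' * h)
    = zpow v (a + a')%R * zpow w (b + b')%R * h.
  by rewrite !zpowD !mulgA; congr (_ * _ * _); rewrite -!mulgA (vwc a' b).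
pose Z h := [set d | d \in D /\ exists a b, h = zpow v a * zpow w b * d].
have Z_eq a b h : Z (zpow v a * zpow w b * h) = Z h.
  apply/seteqP; split=> d [dD [a' [b' hE]]]; split => //; last first.
    by exists (a + a')%R, (b + b')%R; rewrite hE vwD.
  exists (- a + a')%R, (- b + b')%R.
  by rewrite -vwD -hE vwD !addNr !mul1g.
pose rep h := xget 1 (Z h).
have repP h : Z h (rep h).
  by apply: (xgetPex 1); have [a [b [d dD hE]]] := cover h; exists d; split=> //; exists a, b.
have repD h : rep h \in D by case: (repP h).
have /choice[bt btP] : forall h, exists b, exists a, h = zpow v a * zpow w b * rep h.
  by move=> h; have [_ [a [b hE]]] := repP h; exists b, a.
have bt_uniq h a b : h = zpow v a * zpow w b * rep h -> bt h = b.
  have [a' {1}->] := btP h => /mulIg eq_h.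
  have : zpow v (- a + a')%R * zpow w (- b + bt h)%R * 1
      = zpow v (- a + a)%R * zpow w (- b + b)%R * 1 by rewrite -!vwD eq_h.
  by rewrite !addNr !mulg1 => /free; lia.
have bt_act h a b : bt (zpow v a * zpow w b * h) = (b + bt h)%R.
  have [a' hE] := btP h; apply: (bt_uniq _ (a + a')%R).
  by rewrite /rep Z_eq -/(rep h) -vwD -hE.
have xv a h : x (zpow v a * h) = x h.
  elim/int_ind: a h => [|a IHa|a IHa] h; first by rewrite mul1g.
    by rewrite intS zpowD zpow1 -mulgA xv1.
  by rewrite -(xv1 (_ * h)) mulgA -{1}(zpow1 v) -zpowD intS opprD addrA subrr add0r.
(* [M] bounds the change of height caused by the elements of the window [E];
   it is finite because this change only depends on the representative in [D]. *)
have [M MP] : exists M : nat, forall g, {in E, forall e, (`|(bt (g * e)%g - bt g)%R| <= M)%N}.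
  exists (\max_(d <- D) \max_(e <- E) `|bt (d * e)%g|%N) => g e eE.
  have [a gE] := btP g; rewrite {1}gE -mulgA bt_act addrAC subrr add0r.
  apply: leq_trans (leq_bigmax_seq _ (repD g) _) => //.
  exact: (leq_bigmax_seq (F := fun e => `|bt (rep g * e)%g|%N) e eE isT).
(* The word read at heights [k * (M + 1) + s] for [s] between [-M] and [M].  The
   centres are spaced by [M + 1] so that the period [p] exceeds [M]. *)
pose win (k : nat) := [ffun sd : 'I_(M + M).+1 * 'I_(size D) =>
  x (zpow w ((k * M.+1 + sd.1)%N%:Z - M%:Z)%R * nth 1 D sd.2)].
have [|k [k' [kk' /ffunP win_eq]]] := pigeonhole_nat (f := win) (A := setT) _ (fun _ => I).
  exact: finite_finset.
pose i : int := (k * M.+1)%N; pose p : nat := ((k' - k) * M.+1)%N.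
have Mp : (M < p)%N by rewrite /p -subn_gt0 in kk' *; nia.
have x_win (s : int) d : d \in D -> (- M%:Z <= s <= M)%R ->
    x (zpow w (i + p + s)%R * d) = x (zpow w (i + s)%R * d).
  move=> dD sM; have sM' : (`|(s + M)%R|%N < (M + M).+1)%N by lia.
  have dD' : (index d D < size D)%N by rewrite index_mem.
  have := win_eq (Ordinal sM', Ordinal dD'); rewrite !ffunE /= nth_index // => xx.
  have -> : (i + p + s = (k' * M.+1 + `|(s + M)%R|)%N%:Z - M%:Z)%R by rewrite /i /p; nia.
  by rewrite -xx; congr (x (zpow w _ * d)); rewrite /i; lia.
have {}x_win (s : int) u : bt u = 0%R -> (- M%:Z <= s <= M)%R ->
    x (zpow w (i + p + s)%R * u) = x (zpow w (i + s)%R * u).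
  have [a uE] := btP u => u0 sM; rewrite u0 mulg1 in uE.
  by rewrite uE !mulgA -!(vwc a) -!mulgA !xv x_win.
(* [phi b] is the integer among [i], ..., [i + p - 1] congruent to [b] modulo [p]:
   the configuration [y] repeats the stretch of [x] between the equal windows at
   [i] and [i + p]. *)
pose phi (b : int) : int := (i + ((b - i)%R %% p)%Z)%R.
pose y h := x (zpow w (phi (bt h) - bt h)%R * h).
have p0 : (p%:Z != 0)%R by lia.
have y_local g e : e \in E ->
    y (g * e) = x (zpow w (phi (bt g) - bt g)%R * g * e).
  move=> eE; pose b' := bt (g * e); pose u := zpow w (- b')%R * (g * e).
  have u0 : bt u = 0%R.
    by have := bt_act (g * e) 0%R (- b')%R; rewrite mul1g addNr.
  have uE c : zpow w c * (g * e) = zpow w (c + b')%R * u.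
    by rewrite /u [RHS]mulgA -zpowD addrK.
  rewrite /y -mulgA !uE -/b' subrK.
  have := MP g e eE; rewrite -/b'.
  have := modz_ge0 (bt g - i) p0; have := modz_ge0 (b' - i) p0.
  have := ltz_pmod (bt g - i) (d := p); have := ltz_pmod (b' - i) (d := p).
  have := divz_eq (bt g - i) p; have := divz_eq (b' - i) p.
  rewrite /phi; set B := bt g.
  move: ((b' - i)%R %% p)%Z ((B - i)%R %% p)%Z ((b' - i)%R %/ p)%Z ((B - i)%R %/ p)%Z.
  move=> r r' k1 k2 e1 e2 rp r'p r0 r'0 bM.
  have := rp; have := r'p; clear rp r'p => rp r'p.
  (* Shifting by less than the window width leaves the stretch by at most one
     period, and there the two equal windows agree. *)
  have c_eq : (i + r' - B + b' = i + r + (k1 - k2) * p)%R by nia.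
  have [K|[K|K]] : (k1 - k2 = 0 \/ k1 - k2 = 1 \/ k1 - k2 = -1)%R by nia.
  - by congr (x (zpow w _ * u)); nia.
  - have := x_win r u u0; rewrite (_ : i + p + r = i + r' - B + b')%R; last by nia.
    by move=> -> //; lia.
  - have := x_win (r' - B + b' - i + i)%R u u0.
    rewrite (_ : i + p + (r' - B + b' - i + i) = i + r)%R; last by nia.
    move=> ->; last by lia.
    by congr (x (zpow w _ * u)); lia.
exists y.
  apply: (XE x) => // g; exists (zpow w (phi (bt g) - bt g)%R * g) => e eE.
  exact: y_local.
have y_per a (l : int) h : y (zpow v a * zpow w (l * p)%R * h) = y h.
  rewrite /y bt_act /phi.
  rewrite -(addrA (l * p)%R) modzMDl.
  rewrite !mulgA -(vwc a) -!mulgA xv mulgA -zpowD.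
  by congr (x (zpow w _ * h)); lia.
pose orb (rd : 'I_p * 'I_(size D)) h := y (zpow w rd.1 * nth 1 D rd.2 * h).
apply: (@sub_finite_set _ _ (range orb)); last exact/finite_image/finite_finset.
move=> _ [g _ <-]; have [a [b [d dD gE]]] := cover g^-1.
have rp : (`|(b %% p)%Z| < p)%N by have := ltz_pmod b (d := p); have := modz_ge0 b p0; lia.
have dD' : (index d D < size D)%N by rewrite index_mem.
exists (Ordinal rp, Ordinal dD') => //; apply/funext => h.
have -> : orb (Ordinal rp, Ordinal dD') h = y (zpow w (b %% p)%Z * d * h).
  by rewrite /orb /= nth_index // -[(b %% p)%Z]gez0_abs ?modz_ge0.
rewrite /shift gE.
have wb : zpow w b = zpow w ((b %/ p)%Z * p)%R * zpow w (b %% p)%Z.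
  by rewrite -zpowD -divz_eq.
by rewrite -(y_per a (b %/ p)%Z) wb !mulgA.
Qed.

(** * Groups that are virtually Z or virtually Z^2 *)

Section FiniteIndexImage.
Variables (H G : groupType) (f : H -> G).
Hypothesis fM : {morph f : x y / x * y}.

Definition coset_cover (T : seq G) : Prop :=
  forall g, exists2 t, t \in T & exists h, g = t * f h.

(** Two powers of [g] lie in the same coset. *)
Lemma coset_cover_power T : coset_cover T ->
  forall g, exists2 k, (0 < k)%N & exists h, g ^+ k = f h.
Proof.
move=> cT g; have /choice[t tP] : forall n, exists t, t \in T /\ exists h, g ^+ n = t * f h.
  by move=> n; have [t tT gE] := cT (g ^+ n); exists t.
have [|i [j [ij tij]]] := pigeonhole_nat (f := t) (finite_seq T).
  by move=> n; have [] := tP n.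
exists (j - i)%N; first by rewrite subn_gt0.
have [[_ [h gi]] [_ [h' gj]]] := (tP i, tP j); exists (h^-1 * h').
rewrite fM (morphV fM); apply: (@mulgI _ (g ^+ i)); rewrite -expgnDr subnKC ?(ltnW ij) //.
by rewrite gj gi tij -mulgA mulVKg.
Qed.

End FiniteIndexImage.

Lemma virtually_cover (G : groupType) (S : {pred G}) (H : SubGroup.type S) :
  finite_index S -> exists T, coset_cover (val : H -> G) T.
Proof.
move=> /(@finite_image _ _ _ (xget 1)) /finite_seqP[T TE]; exists T => g.
have [h hS gh] : left_coset S g (xget 1 (left_coset S g)).
  by apply: (xgetPex 1); exists (g * val (1 : H)); exists (val (1 : H)) => //; apply: valP.
exists (xget 1 (left_coset S g)).
  have : [set` T] (xget 1 (left_coset S g)); last by [].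
  by rewrite -TE; exists (left_coset S g) => //; exists g.
exists (Sub h hS : H)^-1; rewrite (morphV (@valM _ _ _)) SubK.
by rewrite -gh mulgK.
Qed.

Lemma Zd_param (H : groupType) d : isomorphic_to_Zd H d ->
  exists psi : 'rV[int]_d -> H,
    bijective psi /\ forall x y, psi (x + y)%R = psi x * psi y.
Proof.
case=> phi [psi phiK psiK] phiM; exists psi; split; first by exists phi.
by move=> x y; apply: (can_inj phiK); rewrite phiM !psiK.
Qed.

Lemma virtually_Z_periodic (G : groupType) (A : finType) (X : set (G -> A)) :
  virtually_Zd 1 G -> is_SFT X -> ~ weakly_aperiodic X.
Proof.
move=> [S [H [/(@virtually_cover _ _ H)[T cT]]]].
case/Zd_param=> psi [psi_bij psiD] sftX [[x Xx] aper].
pose w : G := val (psi (const_mx 1)%R).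
have wX n : zpow w n = val (psi (n *: const_mx 1)%R).
  by rewrite (expmapZ psiD) (morph_zpow (@valM _ _ _)).
have [||h||y /aper] := @periodize G A X 1 w [seq t^-1 | t <- T] x _ _ _ sftX Xx.
- exact/commute_sym/commute1.
- move=> a b; rewrite zpow1n mul1g wX.
  have <- : val (psi 0%R) = 1 :> G by have := wX 0%R; rewrite scale0r => <-.
  move=> /val_inj/(bij_inj psi_bij)/rowP/(_ 0%R).
  by rewrite !mxE mulr1.
- have [t tT [h' hE]] := cT h^-1; have [phi phiK psiK] := psi_bij.
  exists 0%R, (- (phi h' 0 0))%R, t^-1; first exact: map_f.
  rewrite mul1g zpowN wX; set u := (_ *: _)%R.
  have -> : u = phi h' by apply/rowP => i; rewrite !mxE !ord1 mulr1.
  by rewrite psiK -[h]invgK hE invgM.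
- by move=> h; rewrite mul1g.
- by [].
Qed.

(** A nontrivial element fixing [x] has a nontrivial power [z] in Z^2.  The vector
    [z'] orthogonal to [z] spans with it a sublattice of index [N = |z|^2],
    which contains [N] Z^2. *)
Lemma virtually_Z2_rigid (G : groupType) (A : finType) (X : set (G -> A)) :
    torsion_free G -> virtually_Zd 2 G -> is_SFT X -> weakly_aperiodic X ->
  strongly_aperiodic X.
Proof.
move=> tfG [S [H [/(@virtually_cover _ _ H)[T cT]]]].
case/Zd_param=> psi [psi_bij psiD] sftX [X0 aper]; split => // x Xx.
have [phi phiK psiK] := psi_bij.
apply/seteqP; split => [g gx|_ ->]; last first.
  by apply/funext => h; rewrite /shift invg1 mul1g.
apply: contrapT => g1.
have [k k0 [h0 gk]] := coset_cover_power (@valM _ _ _) cT g.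
pose z := phi h0; pose z' : 'rV[int]_2 := (\row_j (if j == 0 then - z 0 1 else z 0 0))%R.
have valZ u n : zpow (val (psi u) : G) n = val (psi (n *: u)%R).
  by rewrite (expmapZ psiD) (morph_zpow (@valM _ _ _)).
have val0 : val (psi 0%R) = 1 :> G by have := valZ 0%R 0%R; rewrite scale0r => <-.
have z0 : (z != 0)%R.
  apply/eqP => z0; apply: g1; apply: (tfG g k k0).
  by rewrite gk -val0 -z0 /z psiK.
pose N := (z 0 0 ^+ 2 + z 0 1 ^+ 2)%R.
have N0 : (0 < N)%R.
  have : (z 0 0 != 0 \/ z 0 1 != 0)%R.
    apply/orP; rewrite -negb_and; apply: contra z0 => /andP[/eqP z00 /eqP z01].
    apply/eqP/rowP => -[[|[|//]] i2]; rewrite mxE.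
      by rewrite -z00; congr (z _ _); apply: val_inj.
    by rewrite -z01; congr (z _ _); apply: val_inj.
  by rewrite /N; case=> ?; nia.
pose rV2 (a b : int) : 'rV[int]_2 := (\row_j (if j == 0 then a else b))%R.
have rV2E (u : 'rV[int]_2) : u = rV2 (u 0 0)%R (u 0 1)%R.
  apply/rowP => -[[|[|//]] i2]; rewrite mxE /=; congr (u _ _); exact: val_inj.
pose D := [seq (val (psi (rV2 (Posz rs.1) (Posz rs.2))) * t^-1 : G) |
   rs <- [seq (r, s) | r <- iota 0 `|N|, s <- iota 0 `|N|], t <- T].
have [||h||y /aper] := @periodize G A X (val (psi z)) (val (psi z')) D x _ _ _ sftX Xx.
- by rewrite /commute -!valM -!psiD addrC.
- move=> a b; rewrite !valZ -valM -psiD -val0 => /val_inj/(bij_inj psi_bij)/rowP abz.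
  have := abz 0%R; have := abz 1%R; rewrite !mxE /=.
  move: N0; rewrite /N; move: (z 0 0)%R (z 0 1)%R => c d *; nia.
- have [t tT [h' hE]] := cT h^-1; pose u := phi h'^-1.
  have NN : Posz `|N|%N = N by lia.
  pose u0 := u 0%R 0%R; pose u1 := u 0%R 1%R.
  pose r := (u0 %% N)%Z; pose s := (u1 %% N)%Z.
  pose p := (u0 %/ N)%Z; pose q := (u1 %/ N)%Z.
  exists (p * z 0 0 + q * z 0 1)%R, (q * z 0 0 - p * z 0 1)%R.
  exists (val (psi (rV2 r s)) * t^-1).
    apply/allpairsP; exists ((`|r|%N, `|s|%N), t); split => //=.
      apply/allpairsP; exists (`|r|%N, `|s|%N); rewrite !mem_iota /=.
      have := ltz_pmod u0 N0; have := ltz_pmod u1 N0.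
      have := modz_ge0 u0 (lt0r_neq0 N0); have := modz_ge0 u1 (lt0r_neq0 N0).
      by rewrite /r /s; split => //; lia.
    by rewrite !gez0_abs // modz_ge0 // lt0r_neq0.
  rewrite mulgA !valZ -!valM -!psiD.
  set u' := (_ + _ + _)%R; have -> : u' = u.
    rewrite [RHS]rV2E [LHS]rV2E; congr rV2; rewrite /u' !mxE /=.
      rewrite -/u0 [RHS](divz_eq _ N) -/p -/r /N; ring.
    rewrite -/u1 [RHS](divz_eq _ N) -/q -/s /N; ring.
  by rewrite psiK (morphV (@valM _ _ _)) -[h]invgK hE invgM.
- move=> h; rewrite psiK -gk.
  elim: k {k0 gk} => [|k IHk]; first by rewrite mul1g.
  by rewrite expgS -mulgA -{1}gx /shift mulKg.
- by [].
Qed.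

(** * Generators of subgroups of finite index *)

(** Generation as a monoid, phrased as an induction principle. *)
Definition generates (G : groupType) (s : seq G) (K : set G) : Prop :=
  (forall a, a \in s -> K a) /\
  forall P : set G, P 1 -> (forall a x, a \in s -> P x -> P (a * x)) -> K `<=` P.

Definition subgroup (G : groupType) (K : set G) : Prop :=
  [/\ K 1, forall x y, K x -> K y -> K (x * y) & forall x, K x -> K x^-1].

(** Finite index, witnessed by a list of representatives of the left cosets. *)
Definition cofinite_by (G : groupType) (K : set G) (T : seq G) : Prop :=
  forall g, exists2 t, t \in T & K (t^-1 * g).

(** Closing a generating set under inverses turns it into a set of monoid
    generators. *)
Lemma finitely_generatedP (G : groupType) :
  finitely_generated G -> exists s : seq G, generates s [set: G].
Proof.
case=> S /finite_seqP[s ->] gen_s; exists (s ++ [seq a^-1 | a <- s]).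
split=> // P P1 PM g _.
pose M := [set x : G | forall P : set G, P 1 ->
  (forall a x, a \in s ++ [seq a^-1 | a <- s] -> P x -> P (a * x)) -> P x].
have M1 : M 1 by [].
have MM x y : M x -> M y -> M (x * y).
  move=> Mx My Q Q1 QM; apply: (Mx (fun u => Q (u * y))).
    by rewrite mul1g; apply: My.
  by move=> a u sa Qu; rewrite -mulgA; apply: QM.
have Ms a : a \in s ++ [seq a^-1 | a <- s] -> M a.
  by move=> sa Q Q1 QM; rewrite -(mulg1 a); apply: QM.
have MV x : M x -> M x^-1.
  move=> Mx; apply: (Mx (fun u => M u^-1)); first by rewrite invg1.
  move=> a u sa Mu; rewrite invgM; apply: MM => //; apply: Ms.
  move: sa; rewrite !mem_cat => /orP[sa|/mapP[b sb ->]]; apply/orP.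
    by right; apply: map_f.
  by left; rewrite invgK.
suff : M g by apply.
have : generated [set` s] g by rewrite gen_s.
apply; split=> [|a sa]; last by apply: Ms; rewrite mem_cat sa.
split=> [|x y /set_mem Mx /set_mem My]; apply/mem_set => //.
by apply: MM => //; apply: MV.
Qed.

(** Schreier's lemma.  The elements [t'^-1 * a * t] lying in [K] generate a
    subgroup [H] of [K] such that the set of products [T H] is stable under left
    multiplication by the generators [a], hence is all of [G]; adding the
    representatives lying in [K] gives [K = H]. *)
Lemma schreier (G : groupType) (s : seq G) (K : set G) (T : seq G) :
    generates s [set: G] -> subgroup K -> cofinite_by K T ->
  exists s', generates s' K.
Proof.
move=> [_ gen_s] [K1 KM KV] cK; pose T1 := 1 :: T.
pose U := [seq r.2^-1 * (a * r.1) | a <- s, r <- [seq (t, t') | t <- T1, t' <- T1]] ++ T1.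
exists [seq u <- U | `[<K u>]]; split=> [a|P P1 PM k Kk].
  by rewrite mem_filter => /andP[/asboolP].
have PU u x : u \in U -> K u -> P x -> P (u * x).
  by move=> uU Ku; apply: PM; rewrite mem_filter uU andbT; apply/asboolP.
have [] // : [set x | exists2 t, t \in T1 & exists h, [/\ K h, P h & x = t * h]] k.
  apply: gen_s => //=; first by exists 1; rewrite ?mem_head //; exists 1; rewrite mulg1.
  move=> a x sa [t tT [h [Kh Ph ->]]].
  have [t' t'T Kt'] := cK (a * t).
  exists t'; first by rewrite inE t'T orbT.
  exists (t'^-1 * (a * t) * h); split; [exact: KM| |by rewrite !mulgA mulgV mul1g].
  apply: PU => //; rewrite mem_cat; apply/orP; left; apply/allpairsPdep.
  exists a, (t, t'); split => //; apply: allpairs_f => //.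
  by rewrite inE t'T orbT.
move=> t tT [h [Kh Ph kE]]; rewrite kE; apply: PU => //.
  by rewrite mem_cat tT orbT.
by rewrite -(mulgK h t) -kE; apply: KM => //; apply: KV.
Qed.

Lemma generates_preim (H G : groupType) (f : H -> G) (s : seq G) :
    {morph f : x y / x * y} -> injective f -> generates s (range f) ->
  exists s', generates s' [set: H].
Proof.
move=> fM f_inj [sf gen_s]; pose inv_f g := xget 1 [set h | f h = g].
have inv_fK h : inv_f (f h) = h.
  apply: f_inj; have : [set h' | f h' = f h] (inv_f (f h)) by apply: (xgetPex 1); exists h.
  by [].
exists (map inv_f s); split=> // P P1 PM h _.
have [h' Ph' /f_inj <- //] : (f @` P) (f h).
apply: gen_s; last by exists h.
  by exists 1 => //; apply: morph1.
move=> a x sa [h' Ph' <-]; have [b _ fb] := sf a sa.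
exists (b * h'); last by rewrite fM fb.
by apply: PM => //; apply/mapP; exists a; rewrite // -fb inv_fK.
Qed.

(** * The upper central series of a nilpotent group *)

(** Decides identities of free groups that hold after expanding commutators and
    conjugates and cancelling adjacent inverses. *)
Ltac group_eq := rewrite /commg /conjg
  ?(invgM, invgK, mulgA, mulgK, mulgVK, mulg1, mul1g, mulVg, mulgV, invg1) //.

Lemma commMgJ (G : groupType) (x y z : G) : [~ x * y, z] = [~ x, z] ^ y * [~ y, z].
Proof. by group_eq. Qed.

Lemma commVgJ (G : groupType) (x z : G) : [~ x^-1, z] = [~ x, z]^-1 ^ x^-1.
Proof. by group_eq. Qed.

Section UpperCentral.
Variable G : groupType.
Implicit Types x y z : G.

Fixpoint upper_central (n : nat) : set G :=
  if n is m.+1 then [set x | forall y, upper_central m [~ x, y]] else [set 1].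

Lemma upper_centralJ n x y : upper_central n x -> upper_central n (x ^ y).
Proof.
elim: n x y => [|n IHn] x y /=; first by move->; rewrite conj1g.
by move=> Zx z; rewrite -[z](conjgKV y) -conjRg; apply: IHn.
Qed.

Lemma upper_central_subgroup n : subgroup (upper_central n).
Proof.
elim: n => [|n [Z1 ZM ZV]] /=.
  by split=> [|x y -> ->|x ->]; rewrite ?mulg1 ?invg1.
split.
- by move=> y; rewrite comm1g.
- by move=> x y Zx Zy z; rewrite commMgJ; apply: ZM => //; apply: upper_centralJ.
- by move=> x Zx z; rewrite commVgJ; apply: upper_centralJ; apply: ZV.
Qed.

Lemma upper_centralS n : upper_central n `<=` upper_central n.+1.
Proof.
elim: n => [|n IHn] x /=; first by move=> -> y; rewrite comm1g.
by move=> Zx y; apply: IHn.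
Qed.

Lemma upper_central_nilpotent :
  nilpotent_group G -> exists c, upper_central c = setT.
Proof.
case=> c lc1; exists c; suff Zl i : (i <= c)%N ->
    lower_central (c - i) `<=` upper_central i.
  by apply/seteqP; split=> // x _; apply: (Zl c) => //; rewrite subnn.
elim: i => [|i IHi] ic; first by rewrite subn0 lc1.
move=> x lx y; apply: IHi; first exact: ltnW.
rewrite -(subnSK ic) /= => K [_]; apply.
by exists x => //; exists y.
Qed.

(** The commutator [[~ x, y]] is central modulo the term [n], so that its copies
    can be collected in the expansion of [[~ x ^+ m, y]]. *)
Lemma upper_central_commX n x y m : upper_central n.+2 x ->
  exists2 z, upper_central n z & [~ x ^+ m, y] = [~ x, y] ^+ m * z.
Proof.
move=> Zx; have [Z1 ZM _] := upper_central_subgroup n.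
elim: m => [|m [z Zz IHm]]; first by exists 1; rewrite ?comm1g ?mulg1.
have [Z1' ZM' ZV'] := upper_central_subgroup n.+1.
pose z' := [~ [~ x, y], x ^+ m].
exists (z' ^ ([~ x, y] ^+ m) * z).
  by apply: ZM => //; apply: upper_centralJ; apply: Zx.
rewrite expgS commMgJ IHm expgS /z'.
move: ([~ x, y] ^+ m) (x ^+ m) => u v; group_eq.
Qed.

Definition torsion x := exists2 k, (0 < k)%N & x ^+ k = 1.

Lemma torsion_root x m : (0 < m)%N -> torsion (x ^+ m) -> torsion x.
Proof.
by move=> m0 [k k0 xk]; exists (m * k)%N; rewrite ?muln_gt0 ?m0 // expgnA.
Qed.

Lemma common_exponent (s : seq G) : (forall a, a \in s -> torsion a) ->
  exists2 m, (0 < m)%N & {in s, forall a, a ^+ m = 1}.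
Proof.
elim: s => [|a s IHs] tor; first by exists 1%N.
have [|m m0 sm] := IHs; first by move=> b sb; apply: tor; rewrite inE sb orbT.
have [|k k0 ak] := tor a; first exact: mem_head.
exists (k * m)%N => [|b]; first by rewrite muln_gt0 k0.
rewrite inE => /orP[/eqP->|/sm bm]; first by rewrite expgnA ak expg1n.
by rewrite mulnC expgnA bm expg1n.
Qed.

(** Induction along the series: if the term [n + 1] is torsion and [x] is in the
    next term, the commutators of [x] with the generators have a common exponent
    [m], and then [x ^+ m] commutes with everything modulo the term [n]. *)
Lemma torsion_center (s : seq G) : generates s [set: G] -> nilpotent_group G ->
  (forall x, upper_central 1 x -> torsion x) -> forall x, torsion x.
Proof.
move=> [_ gen_s] /upper_central_nilpotent[c Zc] tor1.
suff tor n x : upper_central n x -> torsion x by move=> x; apply: (tor c); rewrite Zc.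
elim: n x => [|[|n] IHn] x; first by move=> ->; exists 1%N.
  exact: tor1.
move=> Zx; have [|m m0 sm] := @common_exponent [seq [~ x, a] | a <- s].
  by move=> _ /mapP[a _ ->]; apply/IHn/Zx.
apply: (torsion_root m0); apply: IHn => y.
have [Z1 ZM _] := upper_central_subgroup n.
apply: (gen_s [set y | upper_central n [~ x ^+ m, y]]) => //=; first by rewrite commg1.
move=> a u sa Zu; have -> : [~ x ^+ m, a * u] = [~ x ^+ m, u] * [~ x ^+ m, a] ^ u by group_eq.
apply: ZM => //; apply: upper_centralJ.
have [z Zz ->] := @upper_central_commX n x a m Zx.
by rewrite sm ?mul1g //; apply: map_f.
Qed.

End UpperCentral.

(** The quotient [K / H] is a finitely generated abelian torsion group; [D] is the
    set of the products of bounded powers of the generators. *)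
Lemma cofinite_step (G : groupType) (K H : set G) (s T : seq G) :
    subgroup K -> subgroup H -> H `<=` K -> generates s K -> cofinite_by K T ->
    (forall x y, K x -> K y -> H [~ x, y]) ->
    (forall x, K x -> exists2 k, (0 < k)%N & H (x ^+ k)) ->
  exists T', cofinite_by H T'.
Proof.
move=> [K1 KM KV] [H1 HM HV] HK [Ks gen_s] cT KK Kpow.
have KX x n : K x -> K (x ^+ n).
  by move=> Kx; elim: n => // n IHn; rewrite expgS; apply: KM.
have HJ h k : H h -> K k -> H (h ^ k).
  move=> Hh Kk; have -> : h ^ k = h * [~ h, k] by group_eq.
  by apply: HM => //; apply: KK => //; apply: HK.
have [D [D1 KD DP]] : exists D : seq G, [/\ 1 \in D, forall d, d \in D -> K d
    & forall a d, a \in s -> d \in D -> exists2 d', d' \in D & H (d'^-1 * (a * d))].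
  elim: s Ks {gen_s} => [|u s IHs] Ks.
    by exists [:: 1]; split=> [|d|]; rewrite ?mem_head // inE => /eqP->.
  have [|D [D1 KD DP]] := IHs; first by move=> a sa; apply: Ks; rewrite inE sa orbT.
  have Ku : K u by apply/Ks/mem_head.
  have [n n0 Hn] := Kpow u Ku.
  exists [seq u ^+ e * d | e <- iota 0 n, d <- D]; split.
  - by apply/allpairsP; exists (0%N, 1); rewrite mem_iota /= expg0 mulg1.
  - move=> _ /allpairsP[[e d] /= [_ dD ->]]; apply: KM; [exact: KX|exact: KD].
  - move=> a _ + /allpairsP[[e d] /= [eI dD ->]].
    rewrite inE => /orP[/eqP-> {a}|sa]; last first.
      have [d' d'D Hd'] := DP a d sa dD; exists (u ^+ e * d').
        by apply/allpairsP; exists (e, d').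
      have -> : (u ^+ e * d')^-1 * (a * (u ^+ e * d)) =
          d'^-1 * (a * d) * [~ a, u ^+ e] ^ d by group_eq.
      apply: HM => //; apply: HJ; last exact: KD.
      by apply: KK; [apply: Ks; rewrite inE sa orbT|apply: KX].
    rewrite mulgA -expgS; have [en|en] := ltnP e.+1 n.
      exists (u ^+ e.+1 * d); last by rewrite mulVg.
      by apply/allpairsP; exists (e.+1, d); rewrite mem_iota.
    exists d; first by apply/allpairsP; exists (0%N, d); rewrite mem_iota /= expg0 mul1g.
    have -> : e.+1 = n by move: eI; rewrite mem_iota; lia.
    by apply: HJ => //; apply: KD.
exists [seq t * d | t <- T, d <- D] => g; have [t tT Kt] := cT g.
have [d [dD Hd]] : exists d, d \in D /\ H (d^-1 * (t^-1 * g)).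
  apply: (gen_s [set x | exists d, d \in D /\ H (d^-1 * x)]) => //=.
    by exists 1; rewrite mulg1 invg1.
  move=> a x sa [d [dD Hd]]; have [d' d'D Hd'] := DP a d sa dD.
  exists d'; split=> //.
  have -> : d'^-1 * (a * x) = d'^-1 * (a * d) * (d^-1 * x) by group_eq.
  exact: HM.
exists (t * d); first by apply/allpairsP; exists (t, d).
by rewrite invgM -mulgA.
Qed.

Definition cyclic_set (G : groupType) (w : G) : set G := [set zpow w n | n in setT].

Lemma cyclic_subgroup (G : groupType) (w : G) : subgroup (cyclic_set w).
Proof.
split; first by exists 0%R.
  by move=> _ _ [m _ <-] [n _ <-]; exists (m + n)%R; rewrite ?zpowD.
by move=> _ [n _ <-]; exists (- n)%R; rewrite ?zpowN.
Qed.

(** Starting from the whole group, each term of the upper central series, with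
    [<z>] in place of the trivial term, is seen to have finite index; it is then
    finitely generated by Schreier's lemma, so that the descent goes on. *)
Lemma nilpotent_cofinite_cyclic (G : groupType) (s : seq G) (z : G) :
    generates s [set: G] -> nilpotent_group G -> upper_central 1 z ->
    (forall x, exists2 k, (0 < k)%N & cyclic_set z (x ^+ k)) ->
  exists T, cofinite_by (cyclic_set z) T.
Proof.
move=> gen_s /upper_central_nilpotent[c Zc] Zz pow.
pose K n : set G := if n is m.+1 then upper_central n else cyclic_set z.
have KG n : subgroup (K n).
  by case: n => [|n]; [apply: cyclic_subgroup | apply: upper_central_subgroup].
have KS n : K n `<=` K n.+1.
  case: n => [|n]; last exact: upper_centralS.
  move=> _ [n _ <-] y; apply/eqP/commgP/commute_sym/commute_zpow/commute_sym.
  exact/commgP/eqP/Zz.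
have zK n : cyclic_set z `<=` K n.
  by elim: n => // n IHn; apply: subset_trans (KS n).
suff cK i : (i <= c)%N -> exists T, cofinite_by (K (c - i)%N) T.
  by have := cK c (leqnn c); rewrite subnn.
elim: i => [_|i IHi ic].
  exists [:: 1] => g; exists 1; rewrite ?mem_head // subn0.
  case: c Zc => [|c] Zc; last by rewrite /K Zc.
  have -> : 1^-1 * g = 1 by have : upper_central 0 (1^-1 * g) by rewrite Zc.
  by exists 0%R.
have [T cT] := IHi (ltnW ic); rewrite -subnSK // in cT.
have [s' gen_s'] := schreier gen_s (KG _) cT.
apply: (cofinite_step (KG _) (KG _) (KS _) gen_s' cT) => [x y Kx Ky|x _].
  move: Kx; case: (c - i.+1)%N => [|n] Kx; last exact: Kx.
  by have /= -> := Kx y; exists 0%R.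
by have [k k0 xk] := pow x; exists k => //; apply: zK.
Qed.

Lemma nilpotent_torsion_finite (G : groupType) (s : seq G) :
    generates s [set: G] -> nilpotent_group G -> (forall x : G, torsion x) ->
  finite_set [set: G].
Proof.
move=> gen_s nilG tor.
have [|x|T cT] := nilpotent_cofinite_cyclic (z := 1) gen_s nilG.
- by move=> y; rewrite comm1g.
- by have [k k0 xk] := tor x; exists k => //; exists 0%R.
apply: (@sub_finite_set _ _ [set` T]) => // g _; have [t tT [n _]] := cT g.
by rewrite zpow1n => eq1; have -> : g = t by rewrite -(mulVKg t g) -eq1 mulg1.
Qed.

(** * Rigid groups with torsion *)

Section CyclicSubgroup.
Variables (G : groupType) (w : G).

Definition cyclic_pred : {pred G} := [pred g | `[<cyclic_set w g>]].

Lemma cyclic_closed : group_closed cyclic_pred.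
Proof.
have [C1 CM CV] := cyclic_subgroup w.
split=> [|x y /asboolP Cx /asboolP Cy]; apply/asboolP => //.
by apply: CM => //; apply: CV.
Qed.

Record cyclic_type := CyclicType {cyclic_val : G; _ : cyclic_val \in cyclic_pred}.

HB.instance Definition _ := [isSub for cyclic_val].
HB.instance Definition _ := [Choice of cyclic_type by <:].
HB.instance Definition _ :=
  SubChoice_isSubGroup.Build G cyclic_pred cyclic_type cyclic_closed.

End CyclicSubgroup.

Lemma cofinite_cyclic_virtually_Z (G : groupType) (w : G) (T : seq G) :
    (forall n, zpow w n = 1 -> n = 0%R) -> cofinite_by (cyclic_set w) T ->
  virtually_Zd 1 G.
Proof.
move=> w_inf cT; exists (cyclic_pred w), (cyclic_type w); split.
  apply: (@sub_finite_set _ _ [set left_coset (cyclic_pred w) t | t in [set` T]]);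
    last exact/finite_image/finite_seq.
  have [C1 CM CV] := cyclic_subgroup w.
  move=> _ [g _ <-]; have [t tT Ct] := cT g; exists t => //.
  apply/seteqP; split=> _ [h /asboolP Ch <-].
    exists (g^-1 * t * h); last by rewrite !mulgA mulgV mul1g.
    by apply/asboolP/CM => //; rewrite -[g^-1 * t]invgK invgM invgK; apply: CV.
  exists (t^-1 * g * h); last by rewrite !mulgA mulgV mul1g.
  exact/asboolP/CM.
pose H := cyclic_type w.
have /choice[e eP] : forall h : H, exists n, val h = zpow w n.
  by move=> h; have /asboolP[n _ hE] := valP h; exists n.
have w_inj m n : zpow w m = zpow w n -> m = n.
  move=> eq_mn; apply/eqP; rewrite -subr_eq0; apply/eqP/w_inf.
  by rewrite zpowB eq_mn mulgV.
have wC n : zpow w n \in cyclic_pred w by apply/asboolP; exists n.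
exists (fun h : H => const_mx (e h)); last first.
  move=> x y; apply/rowP => i; rewrite !mxE; apply: w_inj.
  by rewrite zpowD -!eP valM.
exists (fun v : 'rV[int]_1 => Sub (zpow w (v 0 0)%R) (wC _) : H).
  by move=> h; apply: val_inj; rewrite SubK mxE -eP.
move=> v; apply/rowP => i; rewrite !mxE ord1; apply: w_inj.
by rewrite -eP SubK.
Qed.

Lemma zpow_eq1_torsion (G : groupType) (z : G) n :
  zpow z n = 1 -> n <> 0%R -> torsion z.
Proof.
case: n => n /= zn n0; first by exists n; [case: n n0 {zn} |].
by exists n.+1 => //; apply/eqP; rewrite -invg_eq1 zn.
Qed.

Lemma coset_cover_infinite (H G : groupType) (f : H -> G) (T : seq G) :
  coset_cover f T -> infinite_set [set: G] -> infinite_set [set: H].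
Proof.
move=> cT infG finH; apply: infG.
have finI : finite_set (([set` T] : set G) `*` [set: H]) by apply: finite_setX.
apply: sub_finite_set (finite_image (fun th => th.1 * f th.2) finI) => g _.
by have [t tT [h ->]] := cT g; exists (t, h).
Qed.

(** A torsion element has no nontrivial power conjugate into a torsion-free
    subgroup, so that rigidity forbids copies of Z^2 in [N]. *)
Lemma rigid_torsion_virtually_Z (N G : groupType) (f : N -> G) (T : seq G)
    (s : seq N) (t : G) :
    {morph f : x y / x * y} -> injective f -> coset_cover f T ->
    generates s [set: N] -> nilpotent_group N -> infinite_set [set: N] ->
    periodically_rigid G -> torsion t -> t <> 1 ->
  virtually_Zd 1 G.
Proof.
move=> fM f_inj cT gen_s nilN infN rigG [m m0 tm] t1.
have fz x n : f (zpow x n) = zpow (f x) n by apply: morph_zpow.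
have no_Z2 (p q : N) : commute p q -> ~ independent p q.
  move=> pq indep.
  have [||k [g [i [j [k0 tk1 tk]]]]] := @rigid_power_conj G (f p) (f q) t rigG _ _ t1.
  - by rewrite /commute -!fM pq.
  - move=> i j; rewrite -!fz -fM -(morph1 fM) => /f_inj; exact: indep.
  have : (zpow p i * zpow q j) ^+ m = 1.
    apply: f_inj; rewrite morphX // fM !fz morph1 //; apply/eqP.
    by rewrite -(conjg_eq1 _ g) conjXg -tk expgnAC tm expg1n.
  rewrite expgMn; last exact: commute_zpow2.
  rewrite -[_ ^+ m]/(zpow _ m%:Z%R) -[zpow q j ^+ m]/(zpow _ m%:Z%R) -!zpowM.
  move=> /indep[im jm]; apply: tk1; rewrite tk.
  have -> : i = 0%R by nia.
  have -> : j = 0%R by nia.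
  by rewrite mulg1 conj1g.
have [z Zz z_inf] : exists2 z : N, upper_central 1 z & ~ torsion z.
  apply: contrapT => noz; apply: infN; apply: (nilpotent_torsion_finite gen_s nilN).
  apply: (torsion_center gen_s nilN) => x Zx; apply: contrapT => x_inf.
  by apply: noz; exists x.
have zC x : commute z x by apply/commgP/eqP; apply: Zz.
have pow x : exists2 k, (0 < k)%N & cyclic_set z (x ^+ k).
  have [i [j [zx ij]]] : exists i j, zpow z i * zpow x j = 1 /\ ~ (i = 0%R /\ j = 0%R).
    apply: contrapT => no_ij; apply: (no_Z2 z x (zC x)) => i j zx.
    by apply: contrapT => ij; apply: no_ij; exists i, j.
  have j0 : j <> 0%R.
    move=> j0; rewrite j0 mulg1 in zx; apply: z_inf; apply: (zpow_eq1_torsion zx) => i0.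
    by apply: ij.
  have xj : zpow x j = zpow z (- i)%R by rewrite zpowN; apply/esym/mulg1_eq.
  case: j j0 xj {ij zx} => [[|k]|k] // _ xj.
    by exists k.+1 => //; exists (- i)%R.
  by exists k.+1 => //; exists i => //; rewrite -[LHS]invgK -zpowN -xj invgK.
have [T' cT'] := nilpotent_cofinite_cyclic gen_s nilN Zz pow.
apply: (@cofinite_cyclic_virtually_Z G (f z) [seq t0 * f t' | t0 <- T, t' <- T']).
  move=> n; rewrite -fz -(morph1 fM) => /f_inj zn; apply: contrapT => n0.
  exact: (z_inf (zpow_eq1_torsion zn n0)).
move=> g; have [t0 t0T [h ->]] := cT g; have [t' t'T [n _ hE]] := cT' h.
exists (t0 * f t'); first exact: allpairs_f.
exists n => //; rewrite -fz hE fM morphV // invgM !mulgA mulgVK //.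
Qed.

(** * Torsion-free rigid groups are virtually abelian *)

(** The product of normal forms in the discrete Heisenberg group. *)
Lemma heisenberg_mul (G : groupType) (a b d : G) (x y z x' y' z' : nat) :
    b * a = a * b * d -> commute d a -> commute d b ->
  (a ^+ x * b ^+ y * d ^+ z) * (a ^+ x' * b ^+ y' * d ^+ z') =
  a ^+ (x + x') * b ^+ (y + y') * d ^+ (z + z' + y * x').
Proof.
move=> ba da db.
have dXa m n : d ^+ m * a ^+ n = a ^+ n * d ^+ m by apply: commuteX2.
have dXb m n : d ^+ m * b ^+ n = b ^+ n * d ^+ m by apply: commuteX2.
have b1a n : b ^+ n * a = a * b ^+ n * d ^+ n.
  elim: n => [|n IHn]; first by rewrite !expg0 mul1g !mulg1.
  by rewrite expgSr -mulgA ba !mulgA IHn -!mulgA (mulgA (d ^+ n)) (dXb n 1%N) -!mulgA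
     -expgSr.
have bXa m n : b ^+ n * a ^+ m = a ^+ m * b ^+ n * d ^+ (n * m).
  elim: m => [|m IHm]; first by rewrite muln0 !expg0 mul1g !mulg1.
  rewrite expgSr mulgA IHm -mulgA (dXa _ 1%N) mulgA -(mulgA (a ^+ m)) b1a.
  by rewrite !mulgA -(mulgA _ (d ^+ n)) -expgnDr mulnS.
rewrite !expgnDr -!mulgA; congr (_ * _).
rewrite (mulgA (d ^+ z)) dXa -!mulgA (mulgA (b ^+ y)) bXa -!mulgA.
congr (_ * (_ * _)); rewrite mulgA -expgnDr mulgA dXb -mulgA -!expgnDr.
by congr (_ * _ ^+ _); lia.
Qed.

(** For [a] in the second centre and [d = [~ b, a] <> 1], each [a * b ^+ i] has a
    power conjugate into [<d, a>].  Two of the conjugating elements lie in the same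
    coset of [N], and an element of [N] moves [a] by a central factor only; hence
    some powers of [a * b ^+ i] and [a * b ^+ j] commute, for [i < j].  In normal
    form their commutator is a nontrivial power of [d]. *)
Lemma rigid_torsion_free_abelian (N G : groupType) (f : N -> G) (T : seq G) :
    {morph f : x y / x * y} -> injective f -> coset_cover f T ->
    nilpotent_group N -> periodically_rigid G -> torsion_free G ->
  forall x y : N, commute x y.
Proof.
move=> fM f_inj cT /upper_central_nilpotent[c Zc] rigG tfG.
have tfN (x : N) n : (0 < n)%N -> x ^+ n = 1 -> x = 1.
  move=> n0 xn; apply: f_inj; rewrite morph1 //; apply: (tfG _ n n0).
  by rewrite -morphX // xn morph1.
have fz x n : f (zpow x n) = zpow (f x) n by apply: morph_zpow.
apply: contrapT => nabN.
have [a Z2a [b ab1]] : exists2 a : N, upper_central 2 a & exists b, [~ a, b] <> 1.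
  apply: contrapT => no_a; apply: nabN => x y; apply/commgP/eqP.
  suff Zn n : upper_central n `<=` upper_central 1 (G := N).
    by apply: (Zn c); rewrite Zc.
  elim: n => [|n IHn] u Zu; first exact: (upper_centralS (n := 0) Zu).
  move=> v; apply: contrapT => uv1; apply: no_a; exists u; last by exists v.
  by move=> w; apply: IHn; apply: Zu.
have cen x u : upper_central 1 x -> commute x u.
  by move=> Zx; apply/commgP/eqP; apply: Zx.
have aC y u : commute [~ a, y] u by apply: cen; apply: Z2a.
pose d := [~ b, a].
have dE : d = [~ a, b]^-1 by rewrite invgR.
have dC u : commute d u.
  by rewrite dE; apply: commute_sym; apply: commuteV; apply: commute_sym; apply: aC.
have ba : b * a = a * b * d by apply: commgC.
have d1 : d <> 1 by rewrite dE => /(congr1 (fun x => x^-1)); rewrite invgK invg1.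
have d_inj m n : d ^+ m = d ^+ n -> (m <= n)%N -> m = n.
  move=> dmn mn; apply/eqP; rewrite eqn_leq mn leqNgt; apply/negP => mn'.
  apply: d1; apply: (tfN d (n - m)%N); first by rewrite subn_gt0.
  by rewrite expgnFr // dmn mulgV.
have ab_pow i k : exists z, (a * b ^+ i) ^+ k = a ^+ k * b ^+ (i * k) * d ^+ z.
  elim: k => [|k [z IHk]]; first by exists 0%N; rewrite muln0 !mulg1.
  exists (z + 0 + i * k * 1)%N; rewrite expgSr IHk.
  have := heisenberg_mul k (i * k) z 1 i 0 ba (dC a) (dC b).
  by rewrite expg1 expg0 mulg1 => ->; rewrite addn1 (mulnSr i k).
have indep : independent (f d) (f a).
  move=> i j; rewrite -!fz -fM -(morph1 fM) => /f_inj daij.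
  have j0 : j = 0%R.
    apply: contrapT => j0; have aj : zpow a j = zpow d (- i)%R.
      by rewrite zpowN; apply/esym/mulg1_eq.
    have abj : commute (zpow a j) b.
      by rewrite aj; apply/commute_sym/commute_zpow/commute_sym/dC.
    have [k k0 abk] : exists2 k, (0 < k)%N & commute (a ^+ k) b.
      case: j j0 abj {daij aj} => [[|k]|k] // _ abj; first by exists k.+1.
      exists k.+1 => //; rewrite -[a ^+ _]invgK.
      exact/commute_sym/commuteV/commute_sym.
    apply: ab1; apply: (tfN _ k k0).
    have [z /= -> ] := @upper_central_commX N 0 a b k Z2a.
    by rewrite mulg1 => <-; apply/eqP/commgP.
  split=> //; rewrite j0 mulg1 in daij; apply: contrapT => i0.
  by have [k k0 /(tfN d k k0)] := zpow_eq1_torsion daij i0.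
have da : commute (f d) (f a) by rewrite /commute -!fM dC.
have conj_pow i : exists r : nat * G * N, [/\ (0 < r.1.1)%N, r.1.2 \in T &
    exists x y, f (a * b ^+ i) ^+ r.1.1 = f ((zpow d x * zpow a y) ^ r.2) ^ r.1.2^-1].
  have [|k [g [x [y [k0 _ tk]]]]] := @rigid_power_conj G _ _ (f (a * b ^+ i)) rigG da indep.
    rewrite -(morph1 fM) => /f_inj abi; apply: ab1; apply/eqP/commgP.
    rewrite -(mulgK (b ^+ i) a) abi mul1g.
    exact/commute_sym/commuteV/commuteX/commute_refl.
  have [t tT [h gE]] := cT g^-1; exists (k, t, h^-1); split=> //; exists x, y.
  rewrite tk -!fz -fM -[g]invgK gE invgM conjgM /=.
  by congr (_ ^ _); rewrite morphJ // morphV.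
have /choice[r rP] := conj_pow.
have [|i [j [ij tij]]] := pigeonhole_nat (f := fun i => (r i).1.2) (finite_seq T).
  by move=> i; have [] := rP i.
have [ki0 _ [xi [yi ri]]] := rP i; have [kj0 _ [xj [yj rj]]] := rP j.
move: ki0 kj0 ri rj tij; move: (r i) (r j) => [[k t] u] [[l t'] u'] /=.
move=> k0 l0 ri rj tt'; rewrite -{}tt' in rj.
have aJ v : a ^ v = a * [~ a, v] by rewrite commgEl mulVKg.
have a_conj v v' : commute (a ^ v) (a ^ v').
  rewrite !aJ; apply: commuteM; last exact/commute_sym/aC.
  by apply/commute_sym/commuteM; [apply: commute_refl | apply/commute_sym/aC].
have kl : commute ((a * b ^+ i) ^+ k) ((a * b ^+ j) ^+ l).
  apply: f_inj; rewrite (fM (_ ^+ k)) (fM (_ ^+ l)) !(morphX fM) ri rj.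
  rewrite -!conjMg -!fM; congr (f _ ^ _).
  have dJ v : d ^ v = d by apply/conjg_fixP/commgP; apply: dC.
  rewrite !conjMg !conj_zpow !dJ; have dX n v : commute (zpow d n) v.
    by apply/commute_sym/commute_zpow/commute_sym/dC.
  apply: commuteM; first exact/commute_sym/dX.
  by apply/commute_sym/commuteM; [exact/commute_sym/dX | apply: commute_zpow2].
have [z zE] := ab_pow i k; have [z' z'E] := ab_pow j l.
move: kl; rewrite /commute zE z'E !(heisenberg_mul _ _ _ _ _ _ ba (dC a) (dC b)).
rewrite (addnC l) (addnC (j * l)%N) => /mulgI dd.
have : (z + z' + i * k * l = z' + z + j * l * k)%N by apply: (d_inj _ _ dd); nia.
have : (i * (k * l) < j * (k * l))%N by rewrite ltn_pmul2r ?muln_gt0 ?k0.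
by move=> lt_ij eq_ij; lia.
Qed.

(** * Torsion-free abelian groups and the rank of a rigid group *)

Definition spanned (d : nat) (H : groupType) : Prop :=
  exists2 psi : 'rV[int]_d -> H,
    forall x y, psi (x + y)%R = psi x * psi y & forall h, exists x, psi x = h.

Lemma abelian_spanned (H : groupType) (s : seq H) :
    (forall x y : H, commute x y) -> generates s [set: H] ->
  exists d, spanned d H.
Proof.
move=> HC [_ gen_s].
suff [d [psi psiD psi_s]] : exists d, exists2 psi : 'rV[int]_d -> H,
    forall x y, psi (x + y)%R = psi x * psi y & {in s, forall a, exists x, psi x = a}.
  exists d, psi => // h; apply: (gen_s [set h | exists x, psi x = h]) => //=.
    by exists 0%R; apply: expmap0.
  by move=> a _ sa [y <-]; have [x <-] := psi_s a sa; exists (x + y)%R.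
elim: s {gen_s} => [|a s [d [psi psiD psi_s]]].
  by exists 0%N, (fun _ => 1) => [x y|//]; rewrite mulg1.
exists (1 + d)%N, (fun v : 'rV[int]_(1 + d) => zpow a (v 0 (lshift d 0))%R * psi (rsubmx v)).
  move=> x y; rewrite mxE zpowD linearD psiD /= !mulgA; congr (_ * _).
  by rewrite -!mulgA; congr (_ * _); apply: HC.
move=> b; rewrite inE => /orP[/eqP->|/psi_s[x <-]].
  exists (row_mx 1%:M 0)%R; rewrite row_mxEl mxE eqxx row_mxKr expmap0 //.
  by rewrite mulg1 zpow1.
by exists (row_mx 0 x)%R; rewrite row_mxEl mxE row_mxKr mul1g.
Qed.

(** As long as the exponent map has a nonzero kernel vector [v], the Smith normal
    form of [v] is a change of basis after which [v] is a multiple of the first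
    basis vector.  The image of this basis vector is torsion, hence trivial, and
    the other basis vectors suffice. *)
Lemma torsion_free_spanned_Zd (H : groupType) d :
    torsion_free H -> spanned d H -> exists d', isomorphic_to_Zd H d'.
Proof.
move=> tfH; elim: d => [|d IHd] [psi psiD psi_surj].
  exists 0%N, (fun=> 0%R); last by move=> x y; rewrite addr0.
  exists psi => x; last by apply/rowP => -[].
  by have [y <-] := psi_surj x; congr psi; apply/rowP => -[].
have [[v v0 psi_v]|psi_inj] := pselect (exists2 v, v != 0%R & psi v = 1); last first.
  have /choice[phi phiK] := psi_surj; exists d.+1, phi; last first.
    move=> x y; have : psi (phi (x * y)%g - (phi x + phi y))%R = 1.
      by rewrite psiD expmapN // psiD !phiK mulgV.
    move=> psi1; apply/eqP; rewrite -subr_eq0; apply/negPn/negP => ne0.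
    by apply: psi_inj; eexists; first exact: ne0.
  exists psi => // v; apply/eqP; rewrite -subr_eq0; apply/negPn/negP => ne0.
  by apply: psi_inj; eexists; first exact: ne0; rewrite psiD expmapN // phiK mulgV.
apply: IHd; have [L Lu [R Ru [e _ vE]]] := int_Smith_normal_form v.
pose chi u := psi (u *m R)%R; pose e0 : 'rV[int]_d.+1 := (delta_mx 0 0)%R.
have chiD x y : chi (x + y)%R = chi x * chi y by rewrite /chi mulmxDl psiD.
pose n := (L 0 0 * e`_0)%R.
have vn : (v = n *: e0 *m R)%R.
  rewrite [LHS]vE; congr (_ *m _)%R; apply/rowP => j.
  rewrite !mxE big_ord1 !mxE eqxx /= eq_sym -val_eqE /=.
  by case: (_ == _); rewrite ?mulr0 ?mulr1 ?mulr0n ?mulr1n.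
have n0 : n <> 0%R by move=> n0; move/eqP: v0; apply; rewrite vn n0 scale0r mul0mx.
have chi_e0 : chi e0 = 1.
  have : zpow (chi e0) n = 1 by rewrite -expmapZ // /chi -vn.
  by move=> /zpow_eq1_torsion/(_ n0)[k k0 /(tfH _ k k0)].
exists (fun u => chi (row_mx (0 : 'M_1) u)%R) => [x y|h].
  have -> : (row_mx (0 : 'M_1) (x + y) = row_mx 0 x + row_mx 0 y)%R.
    by rewrite add_row_mx addr0.
  exact: chiD.
have [u <-] := psi_surj h.
have [w wE] : exists w : 'rV_(1 + d), w = (u *m invmx R)%R by eexists.
exists (rsubmx w).
have -> : psi u = chi w by rewrite /chi wE mulmxKV.
have w_dec : w = (w 0 0 *: e0 + row_mx (0 : 'M_1) (rsubmx w))%R.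
  apply/rowP => j; case: (split_ordP j) => k ->; rewrite [RHS]mxE.
    rewrite (row_mxEl (0%R : 'M_1) (rsubmx w) 0%R k) (ord1 k) !mxE eqxx addr0 -val_eqE mulr1.
    by congr (w _ _); apply: val_inj.
  by rewrite (row_mxEr (0%R : 'M_1) (rsubmx w) 0%R k) !mxE -val_eqE mulr0 add0r.
by rewrite [in RHS]w_dec chiD (expmapZ chiD) chi_e0 zpow1n mul1g.
Qed.

Lemma recurrent_value (T : eqType) (s : seq T) (u : nat -> T) :
  (forall n, u n \in s) -> exists c, forall n, exists2 m, (n <= m)%N & u m = c.
Proof.
move=> us; apply: contrapT => norec.
have /choice[b bP] : forall c, exists n, forall m, (n <= m)%N -> u m <> c.
  move=> c; apply: contrapT => nob; apply: norec; exists c => n.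
  apply: contrapT => non; apply: nob; exists n => m nm umc.
  by apply: non; exists m.
pose M := \max_(c <- s) b c.
apply: (bP (u M) M) => //.
exact: (leq_bigmax_seq (F := b) _ (us M) isT).
Qed.

Local Open Scope ring_scope.
(** The left-hand sides form a 3 x 3 matrix of rank at most 2, whose determinant is
    a Vandermonde determinant up to the factors [a1], [a2], [a3]. *)
Lemma det3_rank2 (x1 x2 x3 y1 y2 y3 p0 p1 p2 q0 q1 q2 a1 a2 a3 i j k : int) :
    a1 = x1 * p0 + y1 * q0 -> a1 * i = x1 * p1 + y1 * q1 ->
    a1 * i ^+ 2 = x1 * p2 + y1 * q2 ->
    a2 = x2 * p0 + y2 * q0 -> a2 * j = x2 * p1 + y2 * q1 ->
    a2 * j ^+ 2 = x2 * p2 + y2 * q2 ->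
    a3 = x3 * p0 + y3 * q0 -> a3 * k = x3 * p1 + y3 * q1 ->
    a3 * k ^+ 2 = x3 * p2 + y3 * q2 ->
  a1 * a2 * a3 * ((j - i) * (k - i) * (k - j)) = 0.
Proof.
move=> e11 e12 e13 e21 e22 e23 e31 e32 e33.
transitivity (a1 * ((a2 * j) * (a3 * k ^+ 2) - (a2 * j ^+ 2) * (a3 * k))
  - (a1 * i) * (a2 * (a3 * k ^+ 2) - (a2 * j ^+ 2) * a3)
  + (a1 * i ^+ 2) * (a2 * (a3 * k) - (a2 * j) * a3)); first by ring.
rewrite e12 e13 e22 e23 e32 e33 e11 e21 e31; ring.
Qed.
Local Close Scope ring_scope.

(** Three points of the moment curve have powers conjugate into [<p, q>] by
    elements of one coset of [N].  Since [N] is abelian, the conjugates of [<p, q>]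
    in question coincide, and a finite-index part of it lies in [N]: the three
    points would have multiples in a common plane. *)
Lemma rigid_rank_le2 (N G : groupType) (f : N -> G) (T : seq G) (d : nat) :
    {morph f : x y / x * y} -> injective f -> coset_cover f T ->
    isomorphic_to_Zd N d -> periodically_rigid G -> torsion_free G ->
  (d <= 2)%N.
Proof.
move=> fM f_inj cT isoN rigG tfG; rewrite leqNgt; apply/negP => d3.
have [psi [[phi phiK psiK] psiD]] := Zd_param isoN.
have NC (x y : N) : commute x y.
  by rewrite -(psiK x) -(psiK y) /commute -!psiD addrC.
have fz x n : f (zpow x n) = zpow (f x) n by apply: morph_zpow.
pose o0 := Ordinal (ltn_trans (isT : 0 < 2)%N d3).
pose o1 := Ordinal (ltn_trans (isT : 1 < 2)%N d3).
pose o2 := Ordinal d3.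
pose p := psi (delta_mx 0 o0)%R; pose q := psi (delta_mx 0 o1)%R.
have indep : independent (f p) (f q).
  move=> i j; rewrite -!fz -fM -!(expmapZ psiD) -psiD -(morph1 fM) -(expmap0 psiD).
  move=> /f_inj/(can_inj phiK)/rowP ij.
  have := ij o0; have := ij o1; rewrite !mxE /=; lia.
have pq : commute (f p) (f q) by rewrite /commute -!fM NC.
pose curve (n : nat) : 'rV[int]_d := (\row_j (Posz n ^+ j))%R.
have conj_pow n : exists r : nat * G, [/\ (0 < r.1)%N, r.2 \in T &
    exists x y, f (psi (curve n)) ^+ r.1 = (zpow (f p) x * zpow (f q) y) ^ r.2^-1].
  have [|k [g [x [y [k0 _ tk]]]]] := @rigid_power_conj G _ _ (f (psi (curve n))) rigG pq indep.
    rewrite -(morph1 fM) -(expmap0 psiD) => /f_inj/(can_inj phiK)/rowP/(_ o0).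
    by rewrite !mxE.
  have [t tT [h gE]] := cT g^-1; exists (k, t); split=> //; exists x, y.
  rewrite tk -!fz -fM -[g]invgK gE invgM conjgM /=; congr (_ ^ _).
  by rewrite -morphV // -morphJ // conjgE (NC h^-1^-1) mulgK.
have /choice[r rP] := conj_pow.
have [|t tP] := @recurrent_value _ T (fun n => (r n).2); first by move=> n; have [] := rP n.
have [i _ ti] := tP 0%N; have [j ij tj] := tP i.+1; have [k jk tk] := tP j.+1.
(* The conjugates of [f p] and [f q] need not lie in the image of [N], but some
   powers of them do. *)
have [m m0 [p' pE]] := coset_cover_power fM cT (f p ^ t^-1).
have [m' m'0 [q' qE]] := coset_cover_power fM cT (f q ^ t^-1).
pose rel (n : nat) (a x y : int) := (a *: curve n = x *: phi p' + y *: phi q')%R.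
have row_eq n : (r n).2 = t -> exists a x y : int, (0 < a)%R /\ rel n a x y.
  have [k0 _ [x [y]]] := rP n; move: (r n) k0 => [l t'] /= k0 + tt'.
  rewrite {}tt' => eq_t.
  exists (l * (m * m'))%N, (x * m')%R, (y * m)%R; split; first by nia.
  apply: (can_inj phiK); apply: f_inj.
  rewrite psiD !(expmapZ psiD) !psiK fM !fz -pE -qE.
  rewrite [zpow _ (_ * _)%N]expgnA eq_t conjMg !conj_zpow.
  have PQ : commute (f p ^ t^-1) (f q ^ t^-1) by rewrite /commute -!conjMg pq.
  move: PQ; move: (f p ^ t^-1) (f q ^ t^-1) => P Q PQ.
  rewrite expgMn; last exact: commute_zpow2.
  rewrite -[_ ^+ _]/(zpow _ (Posz _)) -[zpow Q y ^+ _]/(zpow _ (Posz _)).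
  rewrite -[P ^+ m]/(zpow _ (Posz _)) -[Q ^+ m']/(zpow _ (Posz _)) -!zpowM.
  by congr (zpow _ _ * zpow _ _); nia.
have [a1 [x1 [y1 [a10 e1]]]] := row_eq i ti.
have [a2 [x2 [y2 [a20 e2]]]] := row_eq j tj.
have [a3 [x3 [y3 [a30 e3]]]] := row_eq k tk.
have ent n a x y (c : 'I_d) : rel n a x y ->
    (a * Posz n ^+ c = x * phi p' 0 c + y * phi q' 0 c)%R.
  by move=> /rowP/(_ c); rewrite !mxE.
have ent0 n a x y : rel n a x y -> (a = x * phi p' 0 o0 + y * phi q' 0 o0)%R.
  by move=> /(ent n a x y o0); rewrite /= expr0 mulr1.
have ent1 n a x y : rel n a x y -> (a * Posz n = x * phi p' 0 o1 + y * phi q' 0 o1)%R.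
  by move=> /(ent n a x y o1); rewrite /= expr1.
have ent2 n a x y := ent n a x y o2.
have := det3_rank2 (ent0 _ _ _ _ e1) (ent1 _ _ _ _ e1) (ent2 _ _ _ _ e1)
  (ent0 _ _ _ _ e2) (ent1 _ _ _ _ e2) (ent2 _ _ _ _ e2)
  (ent0 _ _ _ _ e3) (ent1 _ _ _ _ e3) (ent2 _ _ _ _ e3).
by apply/eqP; rewrite !mulf_neq0 ?subr_eq0; lia.
Qed.

Theorem theorem4 (G : groupType)
    (G_inf : infinite_set [set: G]%classic)
    (G_fg : finitely_generated G)
    (G_vnil : virtually_nilpotent G) :
  periodically_rigid G <->
    virtually_Zd 1 G \/ (torsion_free G /\ virtually_Zd 2 G).
Proof.
split; last first.
  case=> [vZ|[tfG vZ2]] A X _ sftX wX.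
    by case: (virtually_Z_periodic vZ sftX wX).
  exact: virtually_Z2_rigid.
move=> rigG; have [S [H [fi nilH]]] := G_vnil.
have [T cT] := @virtually_cover _ _ H fi; have valMH := @valM _ _ H.
have [s gen_s] := finitely_generatedP G_fg.
have [s' gen_s'] : exists s' : seq H, generates s' [set: H].
  have KG : subgroup (range (val : H -> G)).
    split=> [|_ _ [x _ <-] [y _ <-]|_ [x _ <-]].
    - by exists 1 => //; apply: morph1.
    - by exists (x * y) => //; apply: valM.
    - by exists x^-1 => //; apply: morphV.
  have cK : cofinite_by (range (val : H -> G)) T.
    move=> g; have [t tT [h ->]] := cT g; exists t => //.
    by exists h => //; rewrite mulKg.
  have [s0 gen_s0] := schreier gen_s KG cK.
  exact: (generates_preim valMH val_inj gen_s0).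
have infH := coset_cover_infinite cT G_inf.
have [tfG|/existsNP[t]] := pselect (torsion_free G); last first.
  move=> /existsNP[n] /not_implyP[n0 /not_implyP[tn t1]]; left.
  apply: (rigid_torsion_virtually_Z valMH val_inj cT gen_s' nilH infH rigG _ t1).
  by exists n.
have HC := rigid_torsion_free_abelian valMH val_inj cT nilH rigG tfG.
have tfH : torsion_free H.
  move=> h n n0 hn; apply: val_inj; rewrite (morph1 valMH); apply: (tfG _ n n0).
  by rewrite -(morphX valMH) hn (morph1 valMH).
have [d0 spanH] := abelian_spanned HC gen_s'.
have [d isoH] := torsion_free_spanned_Zd tfH spanH.
have := rigid_rank_le2 valMH val_inj cT isoH rigG tfG.
case: d isoH => [|[|[|//]]] isoH _.
- case: infH; have [phi phi_bij _] := isoH.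
  apply: (@sub_finite_set _ _ [set 1]); last exact: finite_set1.
  by move=> h _; apply: (bij_inj phi_bij); apply/rowP => -[].
- by left; exists S, H.
- by right; split=> //; exists S, H.
Qed.
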